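(* Let $d \geq 1$, let $(p_i)_{i=1}^d$ be numbers in $[0,1]$, write $q_i = 1-p_i$ and $p = \min_i p_i$, and let $\mu$ be the product probability measure on $\Omega_d = \{0,1\}^d$ given by $\mu(\{x\}) = \prod_{i : x_i = 1} p_i \prod_{i : x_i = 0} q_i$. Let $\mathcal{F} \subset \Omega_d$ be simply rooted, with $\mu(\mathcal{F}) \leq p$. Then there is an element $1 \leq i \leq d$ such that $\mu(\mathcal{F}_i) \leq p_i\, \mu(\mathcal{F})$, where $\mathcal{F}_i = \{x \in \mathcal{F} : x_i = 1\}$.
   Context: A family $\mathcal{G} \subset \Omega_d$ is union-closed if $x, y \in \mathcal{G}$ implies $x \vee y \in \mathcal{G}$ (coordinatewise maximum). A family $\mathcal{F} \subset \Omega_d$ is simply rooted if its complement $\Omega_d \setminus \mathcal{F}$ is union-closed. For a family $\mathcal{G}$, $\mu(\mathcal{G}) = \sum_{x \in \mathcal{G}} \mu(\{x\})$.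
   Formalization: The case d = 1, F = {(1)}, 0 < p_1 < 1 is excluded: there F is simply rooted and μ(F) = p_1 = p, but μ(F_1) = p_1 > p_1 μ(F), so the claim as stated fails exactly for these instances. *)

(* Defs.v *)
From mathcomp Require Import all_boot all_order all_algebra.
From mathcomp Require Import reals.
Set Implicit Arguments.
Unset Strict Implicit.
Unset Printing Implicit Defensive.
Import Order.TTheory GRing.Theory Num.Theory.

Local Open Scope ring_scope.

Definition cube (d : nat) := {ffun 'I_d -> bool}.

Definition cube_join (d : nat) (x y : cube d) : cube d :=
  [ffun i => x i || y i].

Definition union_closed (d : nat) (G : {set cube d}) : Prop :=
  forall x y : cube d, x \in G -> y \in G -> cube_join x y \in G.

Definition simply_rooted (d : nat) (F : {set cube d}) : Prop :=
  union_closed (~: F).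

Definition point_mass (R : realType) (d : nat) (p : 'I_d -> R) (x : cube d) : R :=
  (\prod_(i < d | x i) p i) * (\prod_(i < d | ~~ x i) (1 - p i)).

Definition mu (R : realType) (d : nat) (p : 'I_d -> R) (F : {set cube d}) : R :=
  \sum_(x in F) point_mass p x.

(* The default value 1 does not affect the minimum when d >= 1 and p_i <= 1. *)
Definition pmin (R : realType) (d : nat) (p : 'I_d -> R) : R :=
  \big[Num.min/1]_(i < d) p i.

Definition slice (d : nat) (F : {set cube d}) (i : 'I_d) : {set cube d} :=
  [set x in F | x i].

(* For d = 1 the family F = {(1)} is simply rooted and mu F = p_1, yet
   mu F_1 = p_1 > p_1 * mu F as soon as 0 < p_1 < 1. *)
Definition exceptional (R : realType) (d : nat) (p : 'I_d -> R)
    (F : {set cube d}) : Prop :=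
  [/\ d = 1%N, F = [set [ffun=> true]] & forall i : 'I_d, 0 < p i < 1].

(* Main.v *)
(** Let f be the indicator of F, a = mu F, and D_i the expectation of the discrete derivative of f
    in direction i, so that mu (F_i) - p_i a = p_i q_i D_i. Comparing Fourier weights on level 1
    and on levels >= 2 gives
      2 a (1 - a) <= sum_i p_i q_i (E (diff_i f)^2 + D_i^2).
    Since the complement of F is union-closed, a point of F has at most one lower neighbour
    outside F, which bounds the positive part of the derivatives and turns this inequality into
      sum_i p_i q_i D_i (1 - D_i) <= 2 a (a - min p) <= 0.
    If every p_i q_i D_i were positive, every D_i would be 1, so F would be {x | x_i = 1} for all i
    simultaneously, which forces d = 1. *)
Require Import Defs.
From mathcomp Require Import all_boot all_order all_algebra.
From mathcomp Require Import reals.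
From mathcomp Require Import ring lra.
Import Order.TTheory GRing.Theory Num.Theory.

Local Open Scope ring_scope.

(** * Resetting one coordinate of a point *)

Definition upd {d : nat} (x : cube d) (i : 'I_d) (b : bool) : cube d :=
  [ffun j => if j == i then b else x j].

Lemma upd_same d (x : cube d) i b : upd x i b i = b.
Proof. by rewrite ffunE eqxx. Qed.

Lemma upd_id d (x : cube d) i : upd x i (x i) = x.
Proof. by apply/ffunP => j; rewrite ffunE; case: eqP => [->|]. Qed.

Lemma upd_upd d (x : cube d) i b c : upd (upd x i b) i c = upd x i c.
Proof. by apply/ffunP => j; rewrite !ffunE; case: eqP. Qed.

Lemma updC d (x : cube d) i j b c :
  i != j -> upd (upd x i b) j c = upd (upd x j c) i b.
Proof.
move=> ij; apply/ffunP => k; rewrite !ffunE.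
by case: (eqVneq k j) => [->|//]; rewrite eq_sym (negbTE ij).
Qed.

(** * Averages, discrete derivatives and expectations *)

Definition depends_on {R : realType} {d : nat} (s : seq 'I_d) (f : cube d -> R) : Prop :=
  forall x y : cube d, {in s, x =1 y} -> f x = f y.

(** Integrates out coordinate [i] but stays a function on the whole cube, so inductions on
    coordinates keep [d] fixed; [depends_on] tracks the coordinates left. *)
Definition avg {R : realType} {d : nat} (p : 'I_d -> R) i (f : cube d -> R) x : R :=
  p i * f (upd x i true) + (1 - p i) * f (upd x i false).

Definition diff {R : realType} {d : nat} i (f : cube d -> R) x : R :=
  f (upd x i true) - f (upd x i false).

Definition expect {R : realType} {d : nat} (p : 'I_d -> R) (f : cube d -> R) : R :=
  \sum_x point_mass p x * f x.

Section Expectation.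
Variables (R : realType) (d : nat) (p : 'I_d -> R).
Implicit Types (f g : cube d -> R) (i j : 'I_d).
Local Notation E := (expect p).

Lemma eq_expect f g : f =1 g -> E f = E g.
Proof. by move=> fg; apply: eq_bigr => x _; rewrite fg. Qed.

Lemma expectD f g : E (fun x => f x + g x) = E f + E g.
Proof. by rewrite -big_split; apply: eq_bigr => x _; rewrite mulrDr. Qed.

Lemma expectZ c f : E (fun x => c * f x) = c * E f.
Proof. by rewrite mulr_sumr; apply: eq_bigr => x _; rewrite mulrCA. Qed.

Lemma expectB f g : E (fun x => f x - g x) = E f - E g.
Proof.
have -> : - E g = -1 * E g by ring.
by rewrite -expectZ -expectD; apply: eq_expect => x; ring.
Qed.

Lemma expect_sum (F : 'I_d -> cube d -> R) :
  E (fun x => \sum_i F i x) = \sum_i E (F i).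
Proof. by rewrite exchange_big; apply: eq_bigr => x _; rewrite mulr_sumr. Qed.

Lemma point_massE x :
  point_mass p x = \prod_i (if x i then p i else 1 - p i).
Proof.
rewrite [RHS](bigID (fun i => x i)) /=; congr (_ * _); apply: eq_bigr => i.
  by move->.
by move/negbTE->.
Qed.

Lemma point_mass_upd x i b :
  point_mass p (upd x i b) = (if b then p i else 1 - p i)
    * \prod_(j | j != i) (if x j then p j else 1 - p j).
Proof.
rewrite point_massE (bigD1 i) //= upd_same; congr (_ * _).
by apply: eq_bigr => j /negbTE ji; rewrite ffunE ji.
Qed.

Lemma expect_cst c : E (fun=> c) = c.
Proof.
rewrite /expect -mulr_suml; under eq_bigr do rewrite point_massE.
rewrite -(bigA_distr_bigA (fun i b => if b then p i else 1 - p i)) /=.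
rewrite big1 ?mul1r // => i _.
by rewrite big_bool /=; ring.
Qed.

(** The cube splits into edges of direction [i], each indexed by its upper endpoint. *)
Lemma sum_cube_pair i (G : cube d -> R) :
  \sum_x G x = \sum_(x : cube d | x i) (G (upd x i true) + G (upd x i false)).
Proof.
rewrite (bigID (fun x : cube d => x i)) big_split /=; congr (_ + _).
  by apply: eq_bigr => x xi; rewrite -[X in upd _ _ X]xi upd_id.
rewrite (reindex_onto (fun x => upd x i false) (fun x => upd x i true)) /=.
  apply: eq_bigl => x; rewrite upd_same upd_upd /=.
  apply/eqP/idP => [<-|xi]; first by rewrite upd_same.
  by rewrite -[X in upd _ _ X]xi upd_id.
by move=> x /negbTE xi; rewrite upd_upd -xi upd_id.
Qed.

Lemma expect_avg i f : E (avg p i f) = E f.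
Proof.
rewrite /expect !(sum_cube_pair i); apply: eq_bigr => x _.
by rewrite /avg !upd_upd !point_mass_upd; ring.
Qed.

Lemma avg_diffC i j f x : i != j -> avg p i (diff j f) x = diff j (avg p i f) x.
Proof. by move=> ij; rewrite /avg /diff !(updC _ _ _ _ _ _ ij); ring. Qed.

Lemma diffC i j f x : i != j -> diff i (diff j f) x = diff j (diff i f) x.
Proof. by move=> ij; rewrite /diff !(updC _ _ _ _ _ _ ij); ring. Qed.

Lemma upd_agree i s b (x y : cube d) :
  {in s, x =1 y} -> {in i :: s, upd x i b =1 upd y i b}.
Proof.
move=> xy j; rewrite inE !ffunE; case: eqP => //= _; exact: xy.
Qed.

Lemma depends_avg i s f : depends_on (i :: s) f -> depends_on s (avg p i f).
Proof. by move=> df x y xy; rewrite /avg; congr (_ * _ + _ * _); apply/df/upd_agree. Qed.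

Lemma depends_diff i s f : depends_on (i :: s) f -> depends_on s (diff i f).
Proof. by move=> df x y xy; rewrite /diff; congr (_ - _); apply/df/upd_agree. Qed.

Lemma expect_depends_nil f x : depends_on [::] f -> E f = f x.
Proof. by move=> df; rewrite -[RHS]expect_cst; apply: eq_expect => y; apply: df. Qed.

(** Two-point variance on each edge: p a^2 + q b^2 = (p a + q b)^2 + p q (a - b)^2 when p + q =
    1. *)
Lemma expect_sqr i f :
  E (fun x => f x ^+ 2) =
  E (fun x => avg p i f x ^+ 2) + p i * (1 - p i) * E (fun x => diff i f x ^+ 2).
Proof.
rewrite -(expect_avg i) -expectZ -expectD; apply: eq_expect => x.
by rewrite /avg /diff; ring.
Qed.

Lemma expect_diff_avg i j f : i != j -> E (diff j (avg p i f)) = E (diff j f).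
Proof.
move=> ij; rewrite -[RHS](expect_avg i).
by apply: eq_expect => x; rewrite avg_diffC.
Qed.

Lemma expect_sqr_diff i j f : i != j ->
  E (fun x => diff j f x ^+ 2) =
  E (fun x => diff j (avg p i f) x ^+ 2)
  + p i * (1 - p i) * E (fun x => diff j (diff i f) x ^+ 2).
Proof.
move=> ij; rewrite (expect_sqr i); congr (_ + _ * _); apply: eq_expect => x.
  by rewrite avg_diffC.
by rewrite diffC.
Qed.

(** * Poincaré inequalities *)

Hypothesis p01 : forall i, 0 <= p i <= 1.

Lemma point_mass_ge0 x : 0 <= point_mass p x.
Proof.
rewrite point_massE; apply: prodr_ge0 => i _.
by have /andP[? ?] := p01 i; case: ifP; rewrite ?subr_ge0.
Qed.

Lemma le_expect f g : (forall x, f x <= g x) -> E f <= E g.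
Proof.
by move=> fg; apply: ler_sum => x _; rewrite ler_wpM2l ?point_mass_ge0.
Qed.

Lemma weight_ge0 i : 0 <= p i * (1 - p i).
Proof. by have /andP[? ?] := p01 i; rewrite mulr_ge0 ?subr_ge0. Qed.

(** Induction on [s]: averaging over [i] splits off exactly the term of direction [i], and does not
    increase the energy in the other directions. *)
Lemma poincare s f : uniq s -> depends_on s f ->
  E (fun x => f x ^+ 2) - E f ^+ 2
  <= \sum_(i <- s) p i * (1 - p i) * E (fun x => diff i f x ^+ 2).
Proof.
elim: s f => [|i s IH] f /=.
  move=> _ df; rewrite big_nil.
  rewrite (expect_depends_nil _ [ffun=> false] df).
  rewrite (expect_depends_nil _ [ffun=> false]) ?subrr //.
  by move=> x y xy; rewrite (df x y).
case/andP=> si us df; rewrite big_cons (expect_sqr i).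
have := IH _ us (depends_avg _ _ _ df); rewrite expect_avg => Hb.
have : \sum_(j <- s) p j * (1 - p j) * E (fun x => diff j (avg p i f) x ^+ 2)
    <= \sum_(j <- s) p j * (1 - p j) * E (fun x => diff j f x ^+ 2).
  rewrite !big_seq; apply: ler_sum => j js.
  have ij : i != j by apply: contraNneq si => ->.
  rewrite (expect_sqr_diff _ _ f ij); apply: ler_wpM2l; rewrite ?weight_ge0 // lerDl.
  rewrite mulr_ge0 ?weight_ge0 //.
  by rewrite -(expect_cst 0); apply: le_expect => x; rewrite sqr_ge0.
lra.
Qed.

(* Levels >= 2 count at least twice in the Dirichlet energy, and level 1 is
   counted a second time by the squared means of the derivatives. *)
Lemma poincare_level2 s f : uniq s -> depends_on s f ->
  2 * (E (fun x => f x ^+ 2) - E f ^+ 2)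
  <= \sum_(i <- s) p i * (1 - p i)
       * (E (fun x => diff i f x ^+ 2) + E (diff i f) ^+ 2).
Proof.
elim: s f => [|i s IH] f /=.
  move=> us df; have := poincare [::] f us df.
  by rewrite !big_nil; lra.
case/andP=> si us df; rewrite big_cons (expect_sqr i).
have := IH _ us (depends_avg _ _ _ df); rewrite expect_avg => Hb.
(* The left side carries the energy of direction [i] twice, the right side once plus the squared
   mean; the gap is the variance of [diff i f], bounded here by mixed second derivatives. *)
have Hg := poincare _ _ us (depends_diff _ _ _ df).
have -> : \sum_(j <- s) p j * (1 - p j)
       * (E (fun x => diff j f x ^+ 2) + E (diff j f) ^+ 2)
  = \sum_(j <- s) p j * (1 - p j)
       * (E (fun x => diff j (avg p i f) x ^+ 2) + E (diff j (avg p i f)) ^+ 2)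
    + p i * (1 - p i) * \sum_(j <- s) p j * (1 - p j)
       * E (fun x => diff j (diff i f) x ^+ 2).
  rewrite mulr_sumr -big_split /= !big_seq; apply: eq_bigr => j js.
  have ij : i != j by apply: contraNneq si => ->.
  by rewrite (expect_diff_avg _ _ f ij) (expect_sqr_diff _ _ f ij); ring.
have := ler_wpM2l (weight_ge0 i) Hg.
lra.
Qed.

End Expectation.

(** * Indicators of simply rooted families *)

Definition ind {R : realType} {d : nat} (F : {set cube d}) (x : cube d) : R :=
  (x \in F)%:R.

Section Families.
Variables (R : realType) (d : nat) (p : 'I_d -> R) (F : {set cube d}).
Local Notation E := (expect p).
Local Notation f := (@ind R d F).

Lemma mu_expect : mu p F = E f.
Proof.
rewrite /mu /expect big_mkcond; apply: eq_bigr => x _.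
by rewrite /ind; case: (x \in F); rewrite ?mulr1 ?mulr0.
Qed.

Lemma mu_slice i : mu p (slice F i) = E (fun x : cube d => (x i)%:R * f x).
Proof.
rewrite /mu /expect big_mkcond; apply: eq_bigr => x _.
rewrite inE /ind; case: (x \in F); case: (x i) => /=.
all: by rewrite ?(mulr1, mul1r, mulr0, mul0r).
Qed.

Lemma mu_slice_diff i :
  mu p (slice F i) - p i * mu p F = p i * (1 - p i) * E (diff i f).
Proof.
rewrite mu_slice mu_expect -(expect_avg _ _ p i) -[E f](expect_avg _ _ p i).
rewrite -!expectZ -expectB; apply: eq_expect => x.
by rewrite /avg /diff !upd_same /=; ring.
Qed.

(* If both lower neighbours in directions i and j lay outside F, so would
   their join, which is x. *)
Lemma simply_rooted_edge x i j : simply_rooted F -> x \in F -> x i -> x j ->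
  upd x i false \notin F -> upd x j false \notin F -> i = j.
Proof.
move=> hF xF xi xj; rewrite -!in_setC => Fi Fj.
apply/eqP/negPn/negP => ij; have := hF _ _ Fi Fj.
suff -> : cube_join (upd x i false) (upd x j false) = x by rewrite inE xF.
apply/ffunP => k; rewrite !ffunE.
case: (eqVneq k i) => [->|_]; first by rewrite (negbTE ij) xi.
by case: (eqVneq k j) => [->|_]; rewrite ?xj ?orbb.
Qed.

(** A summand is nonzero only if [x] is in [F] and its lower neighbour is not; by
    [simply_rooted_edge] this happens for at most one direction. *)
Lemma sum_boundary_le (x : cube d) : simply_rooted F ->
  \sum_i (x i)%:R * (f x * (1 - f (upd x i false))) <= f x.
Proof.
move=> hF; rewrite /ind; case xF: (x \in F); last first.
  by rewrite big1 // => i _; rewrite mul0r mulr0.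
under eq_bigr do rewrite mul1r.
have [i|H] := pickP (fun i => x i && (upd x i false \notin F)).
  case/andP=> xi Fi; rewrite (bigD1 i) //= xi (negbTE Fi) big1 => [|j ji] /=; first lra.
  case xj: (x j); last by rewrite mul0r.
  case Fj: (upd x j false \in F); first by rewrite subrr mulr0.
  by rewrite (simply_rooted_edge x i j hF xF xi xj Fi (negbT Fj)) eqxx in ji.
rewrite big1 => [|i _]; first exact: ler01.
have := H i; case: (x i) => /=; last by rewrite mul0r.
by move/negbFE ->; rewrite subrr mulr0.
Qed.

(** Trades the square for the positive part of the derivative, which rootedness controls, and a
    linear term. *)
Lemma sqr_diff_ind i x :
  diff i f x ^+ 2 = 2 * (f (upd x i true) * (1 - f (upd x i false))) - diff i f x.
Proof.
by rewrite /diff /ind; case: (_ \in F); case: (_ \in F) => /=; ring.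
Qed.

Lemma diff_ind_le1 i x : diff i f x <= 1.
Proof.
by rewrite /diff /ind; case: (_ \in F); case: (_ \in F) => /=; lra.
Qed.

Hypothesis p01 : forall i, 0 <= p i <= 1.

(** The factor [p i] turns the sum over edges into one over their upper endpoints, where
    [sum_boundary_le] applies pointwise. *)
Lemma sum_pos_diff_le : simply_rooted F ->
  \sum_i p i * E (fun x => f (upd x i true) * (1 - f (upd x i false))) <= E f.
Proof.
move=> hF.
have -> : \sum_i p i * E (fun x => f (upd x i true) * (1 - f (upd x i false)))
  = E (fun x : cube d => \sum_i (x i)%:R * (f x * (1 - f (upd x i false)))).
  rewrite expect_sum; apply: eq_bigr => i _.
  rewrite -[RHS](expect_avg _ _ p i) -expectZ; apply: eq_expect => x.
  by rewrite /avg !upd_same !upd_upd /=; ring.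
by apply: le_expect => // x; apply: sum_boundary_le.
Qed.

Lemma pmin_le i : pmin p <= p i.
Proof. by rewrite /pmin; apply: bigmin_le_cond. Qed.

Lemma sum_diff_le : simply_rooted F -> mu p F <= pmin p ->
  \sum_i p i * (1 - p i) * (E (diff i f) * (1 - E (diff i f))) <= 0.
Proof.
rewrite mu_expect => hF hmu.
set P := fun i => E (fun x => f (upd x i true) * (1 - f (upd x i false))).
have P0 i : 0 <= P i.
  rewrite -(expect_cst _ _ p 0); apply: le_expect => // x.
  by rewrite /ind; case: (_ \in F); case: (_ \in F) => /=; lra.
have f0 : 0 <= E f.
  by rewrite -(expect_cst _ _ p 0); apply: le_expect => // x; apply: ler0n.
have hvar := poincare_level2 _ _ p p01 (enum 'I_d) f (enum_uniq _).
have {hvar} := hvar _; rewrite !big_enum /=.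
have -> : E (fun x => f x ^+ 2) = E f.
  by apply: eq_expect => x; rewrite /ind; case: (_ \in F) => /=; ring.
have -> : \sum_i p i * (1 - p i)
      * (E (fun x => diff i f x ^+ 2) + E (diff i f) ^+ 2)
  = 2 * (\sum_i p i * (1 - p i) * P i)
    - \sum_i p i * (1 - p i) * (E (diff i f) * (1 - E (diff i f))).
  rewrite mulr_sumr -sumrB; apply: eq_bigr => i _.
  rewrite (eq_expect _ _ _ _ _ (sqr_diff_ind i)) expectB expectZ -/(P i); ring.
move=> hvar; have {hvar} /hvar : depends_on (enum 'I_d) f.
  by move=> x y xy; congr f; apply/ffunP => i; apply: xy; rewrite mem_enum.
(* Only 1 - p_i is bounded; the remaining sum of p_i P_i is at most a, giving 2 a (1 - min p) - 2 a
   (1 - a) = 2 a (a - min p) at the end. *)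
have hP : \sum_i p i * (1 - p i) * P i <= (1 - pmin p) * \sum_i p i * P i.
  rewrite mulr_sumr; apply: ler_sum => i _.
  rewrite [_ * (1 - p i)]mulrC -mulrA; apply: ler_wpM2r; last by rewrite lerB ?pmin_le.
  by rewrite mulr_ge0 //; case/andP: (p01 i).
have := ler_wpM2l f0 hmu.
have m1 : 0 <= 1 - pmin p by rewrite subr_ge0 /pmin bigmin_le_id.
have := ler_wpM2l m1 (sum_pos_diff_le hF).
rewrite -/P; lra.
Qed.

(** The nonnegative function [1 - diff i f] has mean zero and every point has positive mass, so each
    edge of direction [i] has its upper end in [F] and its lower end outside. *)
Lemma expect_diff_eq1 i : (forall j, 0 < p j < 1) -> E (diff i f) = 1 ->
  forall x : cube d, (x \in F) = x i.
Proof.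
move=> p01s D1 x.
have w0 y : 0 < point_mass p y.
  rewrite point_massE; apply: prodr_gt0 => j _.
  by have /andP[? ?] := p01s j; case: ifP; rewrite ?subr_gt0.
have : E (fun y => 1 - diff i f y) = 0 by rewrite expectB expect_cst D1 subrr.
move/eqP; rewrite psumr_eq0 => [|y _]; last first.
  by rewrite mulr_ge0 ?(ltW (w0 y)) // subr_ge0 diff_ind_le1.
move/allP/(_ x); rewrite mem_index_enum => /(_ isT).
rewrite mulf_eq0 gt_eqF //= subr_eq0 /diff /ind.
rewrite -{3}(upd_id _ x i).
case: (x i); case: (_ \in F); case: (_ \in F) => //=.
all: by rewrite ?subrr ?subr0 ?sub0r ?oner_eq0 //; lra.
Qed.

End Families.

(** * Contradiction outside the exceptional case *)

Theorem theorem2p5 (R : realType) (d : nat) (hd : (1 <= d)%N)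
    (p : 'I_d -> R) (hp : forall i : 'I_d, 0 <= p i <= 1)
    (F : {set cube d}) (hF : simply_rooted F) (hmu : mu p F <= pmin p)
    (hexc : ~ exceptional p F) :
  exists i : 'I_d, mu p (slice F i) <= p i * mu p F.
Proof.
have [i le_i|hlt] := pickP (fun i => mu p (slice F i) <= p i * mu p F).
  by exists i.
exfalso.
have hpos i : 0 < p i * (1 - p i) * expect p (diff i (ind F)).
  by rewrite -mu_slice_diff subr_gt0 ltNge hlt.
have ps i : 0 < p i < 1.
  have := lt0r_neq0 (hpos i); rewrite !mulf_eq0 !negb_or subr_eq0.
  case/andP=> /andP[pi0 pi1] _.
  by rewrite !lt_neqAle [0 == _]eq_sym [p i == 1]eq_sym pi0 pi1 hp.
have D1 i : expect p (diff i (ind F)) = 1.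
  have le1 j : expect p (diff j (ind F)) <= 1.
    by rewrite -[leRHS](expect_cst _ _ p); apply: le_expect => // x; apply: diff_ind_le1.
  (* All terms are nonnegative while [sum_diff_le] makes their sum nonpositive, so each vanishes. *)
  have t0 j : true -> 0 <= p j * (1 - p j)
      * (expect p (diff j (ind F)) * (1 - expect p (diff j (ind F)))).
    by move=> _; rewrite mulrA mulr_ge0 ?(ltW (hpos j)) // subr_ge0.
  have s0 := sum_diff_le _ _ p F hp hF hmu.
  have /eqP := le_anti (introT andP (conj s0 (sumr_ge0 _ t0))).
  rewrite psumr_eq0 // => /allP/(_ i); rewrite mem_index_enum => /(_ isT).
  by rewrite mulrA mulf_eq0 gt_eqF //= subr_eq0 => /eqP.
have FE i := expect_diff_eq1 _ _ p F i ps (D1 i).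
pose i0 := Ordinal hd.
(* The indicator of {i} lies in [F] by [FE i], so by [FE i0] its coordinate [i0] is true. *)
have all0 i : i = i0.
  have := FE i [ffun k => k == i]; rewrite (FE i0) !ffunE eqxx.
  by move/eqP.
apply: hexc; split=> //.
  rewrite -[LHS]card_ord -(card1 i0); apply: eq_card => i.
  by rewrite !inE [i]all0 eqxx.
apply/setP => x; rewrite inE (FE i0); apply/idP/eqP => [xi|->]; last by rewrite ffunE.
by apply/ffunP => i; rewrite (all0 i) ffunE.
Qed.
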